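(* For any $\alpha\in(0,1)$ and any $p,q>0$ there exist positive definite $2\times2$ matrices $A,B$ such that $R_{\alpha,p}(A,B)\not\le_{\mathrm{near}}\mathcal{A}_{\alpha,q}(A,B)$; hence also $R_{\alpha,p}(A,B)\not\le\mathcal{A}_{\alpha,q}(A,B)$ and $R_{\alpha,p}(A,B)\not\le_{\mathrm{chao}}\mathcal{A}_{\alpha,q}(A,B)$.
   Context: For positive definite $A,B$: $R_{\alpha,p}(A,B):=\bigl(A^{\frac{1-\alpha}{2}p}B^{\alpha p}A^{\frac{1-\alpha}{2}p}\bigr)^{1/p}$ and $\mathcal{A}_{\alpha,q}(A,B):=((1-\alpha)A^q+\alpha B^q)^{1/q}$. For positive definite $X,Y$: $X\le Y$ is the Loewner order; $X\le_{\mathrm{chao}}Y$ (chaotic order) means $\log X\le\log Y$; $X\le_{\mathrm{near}}Y$ (near order) means $X\#Y^{-1}\le I$, where $X\#Z:=X^{1/2}(X^{-1/2}ZX^{-1/2})^{1/2}X^{1/2}$ is the geometric mean. *)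

(* Defs.v *)
From HB Require Import structures.
From mathcomp Require Import all_boot all_order all_algebra.
From mathcomp Require Import complex.
From mathcomp Require Import reals exp.
Set Implicit Arguments. Unset Strict Implicit. Unset Printing Implicit Defensive.
Import Order.TTheory GRing.Theory Num.Theory.
Local Open Scope ring_scope.
Local Open Scope complex_scope.

Section Defs.
Variable R : realType.
Local Notation C := R[i].

Definition adj2 (M : 'M[C]_2) : 'M[C]_2 := (map_mx conjc M)^T.

Definition hermitian2 (M : 'M[C]_2) : Prop := adj2 M = M.

Definition qform (M : 'M[C]_2) (v : 'cV[C]_2) : C :=
  ((map_mx conjc v)^T *m M *m v) 0 0.

Definition posdef2 (M : 'M[C]_2) : Prop :=
  hermitian2 M /\ forall v : 'cV[C]_2, v != 0 -> 0 < qform M v.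

Definition loewner2 (X Y : 'M[C]_2) : Prop :=
  forall v : 'cV[C]_2, 0 <= qform (Y - X) v.

(* the two (real) eigenvalues of a Hermitian 2x2 matrix, lam1 >= lam2 *)
Definition mtr (M : 'M[C]_2) : R := complex.Re (\tr M).
Definition mdet (M : 'M[C]_2) : R := complex.Re (\det M).
Definition lam1 (M : 'M[C]_2) : R :=
  (mtr M + Num.sqrt (mtr M ^+ 2 - 4 * mdet M)) / 2.
Definition lam2 (M : 'M[C]_2) : R :=
  (mtr M - Num.sqrt (mtr M ^+ 2 - 4 * mdet M)) / 2.

(* Functional calculus f(M) for a Hermitian 2x2 matrix M, via the spectral
   decomposition written through the spectral projections
   P1 = (M - lam2 I)/(lam1 - lam2), P2 = (M - lam1 I)/(lam2 - lam1);
   when lam1 = lam2, M = lam1 I and f(M) = f(lam1) I. *)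
Definition mfun (f : R -> R) (M : 'M[C]_2) : 'M[C]_2 :=
  let l1 := lam1 M in let l2 := lam2 M in
  if l1 == l2 then (f l1)%:C%:M
  else ((f l1 / (l1 - l2))%:C *: (M - l2%:C%:M)
        + (f l2 / (l2 - l1))%:C *: (M - l1%:C%:M)).

Definition mpow (M : 'M[C]_2) (t : R) : 'M[C]_2 := mfun (fun x => powR x t) M.
Definition mlog (M : 'M[C]_2) : 'M[C]_2 := mfun (@ln R) M.

Definition gmean (X Y : 'M[C]_2) : 'M[C]_2 :=
  mpow X (1/2) *m mpow (mpow X (-(1/2)) *m Y *m mpow X (-(1/2))) (1/2)
    *m mpow X (1/2).

Definition chao2 (X Y : 'M[C]_2) : Prop := loewner2 (mlog X) (mlog Y).

Definition near2 (X Y : 'M[C]_2) : Prop := loewner2 (gmean X (invmx Y)) 1%:M.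

Definition Rap (alpha p : R) (A B : 'M[C]_2) : 'M[C]_2 :=
  mpow (mpow A ((1 - alpha) / 2 * p) *m mpow B (alpha * p)
          *m mpow A ((1 - alpha) / 2 * p)) (1 / p).

Definition Aaq (alpha q : R) (A B : 'M[C]_2) : 'M[C]_2 :=
  mpow ((1 - alpha)%:C *: mpow A q + alpha%:C *: mpow B q) (1 / q).

End Defs.

(* Main.v *)
(** Take [A = diag(a, 1)] and let [B] have the same eigenvalues, with eigenvectors
    rotated by a small angle, the entry of the eigenprojection off the diagonal
    being [w = sqrt (z (1 - z))]. Then [X = Rap A B] and [Y = Aaq A B] have traces
    differing by [O(z)], while the difference of their entries off the diagonal
    is of order [w], hence of order [sqrt z]: the first-order terms
    of the two means have different coefficients there, namely
    [x (y - 1) / (x^2 y - 1)] and [alpha], where [x = a^((1 - alpha) p / 2)] and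
    [y = a^(alpha p)]. The same holds for [log X] and [log Y]. A positive
    semidefinite matrix is bounded by its trace, so for small [z] neither
    [Y - X] nor [log Y - log X] is positive semidefinite. For the near order,
    [G = X # Y^-1] satisfies [G Y G = X]; if [G <= 1], then since [1 <= Y] the
    trace of [1 - G] is at most that of [Y - X], and [Y - X = Y - G Y G] is bounded
    entrywise by a multiple of the trace of [1 - G]: again impossible. *)

Require Import Defs.
From HB Require Import structures.
From mathcomp Require Import all_boot all_order all_algebra.
From mathcomp Require Import complex.
From mathcomp Require Import reals exp.
From mathcomp Require Import ring lra.
From mathcomp Require Import all_classical all_analysis.
Set Implicit Arguments. Unset Strict Implicit. Unset Printing Implicit Defensive.
Import Order.TTheory GRing.Theory Num.Theory.
Import numFieldNormedType.Exports.
Local Open Scope classical_set_scope.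
Local Open Scope ring_scope.
Local Open Scope complex_scope.

(** * Symmetric matrices in spectral form *)

Definition sym {R : realType} (x y o : R) : 'M[R]_2 :=
  \matrix_(i, j) if i == j then if i == 0 then x else y else o.

Definition cplx {R : realType} (M : 'M[R]_2) : 'M[R[i]]_2 :=
  map_mx (real_complex R) M.

(* Eigenvalues [l1], [l2], with eigenprojection [[1 - z, w], [w, z]] for [l1];
   this matrix is a projection exactly when [w ^+ 2 = z * (1 - z)]. *)
Definition spec {R : realType} (l1 l2 z w : R) : 'M[R]_2 :=
  sym (l2 + (l1 - l2) * (1 - z)) (l2 + (l1 - l2) * z) ((l1 - l2) * w).

Lemma matrix2P (T : Type) (M N : 'M[T]_2) :
  M 0 0 = N 0 0 -> M 1 1 = N 1 1 -> M 0 1 = N 0 1 -> M 1 0 = N 1 0 -> M = N.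
Proof.
move=> h00 h11 h01 h10; apply/matrixP=> i j.
have ord2 (k : 'I_2) : k = 0 \/ k = 1.
  by case: k => [[|[|k]] lt_k2] //; [left | right]; apply: val_inj.
by case: (ord2 i) => ->; case: (ord2 j) => ->.
Qed.

Lemma mulmx2E (K : pzSemiRingType) (m n : nat) (M : 'M[K]_(m, 2)) (N : 'M[K]_(2, n)) i j :
  (M *m N) i j = M i 0 * N 0 j + M i 1 * N 1 j.
Proof.
rewrite mxE !big_ord_recl big_ord0 addr0.
by congr (_ + M i _ * N _ j); apply: val_inj.
Qed.

Lemma det2E (K : comPzRingType) (M : 'M[K]_2) :
  \det M = M 0 0 * M 1 1 - M 0 1 * M 1 0.
Proof.
have lift01 : lift 0 0 = 1 :> 'I_2 by apply: val_inj.
have lift10 : lift 1 0 = 0 :> 'I_2 by apply: val_inj.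
rewrite (expand_det_row _ 0) !big_ord_recl big_ord0 addr0 /cofactor !det_mx11.
rewrite !mxE lift01 lift10 /= expr0 expr1.
by rewrite mul1r mulN1r mulrN.
Qed.

Lemma mxtrace2E (K : pzSemiRingType) (M : 'M[K]_2) : \tr M = M 0 0 + M 1 1.
Proof.
rewrite /mxtrace !big_ord_recl big_ord0 addr0.
by congr (_ + M _ _); apply: val_inj.
Qed.

Lemma symE (R : realType) (x y o : R) :
  (sym x y o 0 0 = x) * (sym x y o 1 1 = y) *
  (sym x y o 0 1 = o) * (sym x y o 1 0 = o).
Proof. by rewrite !mxE. Qed.

(** Trace and determinant are [l1 + l2] and [l1 * l2], so the discriminant is [(l1 - l2) ^+ 2] and
    the quadratic formula returns [l1], [l2] in this order; the eigenprojection is untouched by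
    [f]. *)
Lemma mfun_spec (R : realType) (f : R -> R) (l1 l2 z w : R) :
  l2 <= l1 -> w ^+ 2 = z * (1 - z) ->
  Defs.mfun f (cplx (spec l1 l2 z w)) = cplx (spec (f l1) (f l2) z w).
Proof.
move=> le_l w2.
have tr_l : mtr (cplx (spec l1 l2 z w)) = l1 + l2.
  by rewrite /mtr /cplx trace_map_mx /= mxtrace2E !symE; ring.
have det_l : mdet (cplx (spec l1 l2 z w)) = l1 * l2.
  rewrite /mdet /cplx det_map_mx /= det2E !symE.
  have -> : (l1 - l2) * w * ((l1 - l2) * w) = (l1 - l2) ^+ 2 * (z * (1 - z)).
    by rewrite -w2; ring.
  ring.
have disc : Num.sqrt ((l1 + l2) ^+ 2 - 4 * (l1 * l2)) = l1 - l2.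
  have -> : (l1 + l2) ^+ 2 - 4 * (l1 * l2) = (l1 - l2) ^+ 2 by ring.
  by rewrite sqrtr_sqr ger0_norm // subr_ge0.
have lam1E : lam1 (cplx (spec l1 l2 z w)) = l1.
  by rewrite /lam1 tr_l det_l disc; field.
have lam2E : lam2 (cplx (spec l1 l2 z w)) = l2.
  by rewrite /lam2 tr_l det_l disc; field.
rewrite /Defs.mfun lam1E lam2E; case: eqP => [<-|/eqP ne_l].
  rewrite /cplx -map_scalar_mx; congr map_mx.
  by apply: matrix2P; rewrite !symE !mxE /= ?subrr ?mul0r ?addr0.
have nz12 : l1 - l2 != 0 by rewrite subr_eq0.
have nz21 : l2 - l1 != 0 by rewrite subr_eq0 eq_sym.
rewrite /cplx -!map_scalar_mx -!map_mxB -!map_mxZ -map_mxD; congr map_mx.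
by apply: matrix2P; rewrite !mxE /= ?mulr1n ?mulr0n ?subr0; field; rewrite ?nz12 ?nz21.
Qed.

Lemma spec_decomposition (R : realType) (x y o : R) :
  exists l1 l2 z w : R,
    [/\ l2 <= l1, w ^+ 2 = z * (1 - z) & sym x y o = spec l1 l2 z w].
Proof.
pose s := Num.sqrt ((x - y) ^+ 2 + 4 * o ^+ 2).
have disc_ge0 : 0 <= (x - y) ^+ 2 + 4 * o ^+ 2.
  by have := sqr_ge0 (x - y); have := sqr_ge0 o; lra.
have s2 : s ^+ 2 = (x - y) ^+ 2 + 4 * o ^+ 2 by rewrite sqr_sqrtr.
have s_ge0 : 0 <= s by apply: sqrtr_ge0.
have [s0|sn0] := eqVneq s 0.
  have {}s0 : (x - y) ^+ 2 + 4 * o ^+ 2 = 0 by rewrite -s2 s0 expr0n.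
  have o0 : o = 0.
    apply/eqP; rewrite -sqrf_eq0; apply/eqP; have := sqr_ge0 (x - y).
    by have := sqr_ge0 o; lra.
  have xy : y = x.
    apply/eqP; rewrite -subr_eq0 -sqrf_eq0; apply/eqP.
    by move: s0; rewrite o0; lra.
  exists x, x, 0, 0; split; rewrite ?expr0n ?mul0r //.
  by apply: matrix2P; rewrite !symE ?o0 ?xy; ring.
have sn2 : s ^+ 2 != 0 by rewrite expf_neq0.
(* The eigenvalues come from the quadratic formula; [z] and [w] solve [y = l2 + s * z] and
   [o = s * w]. *)
exists ((x + y + s) / 2), ((x + y - s) / 2), ((y - x + s) / (2 * s)), (o / s).
split; first by lra.
  have -> : (y - x + s) / (2 * s) * (1 - (y - x + s) / (2 * s)) =
            (s ^+ 2 - (x - y) ^+ 2) / (4 * s ^+ 2) by field.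
  by rewrite expr_div_n s2; rewrite s2 in sn2; field.
by apply: matrix2P; rewrite !symE; field.
Qed.

(** * Positive semidefinite symmetric matrices *)

(* For the matrix [sym x y o]. *)
Definition psd {R : realType} (x y o : R) : Prop :=
  [/\ 0 <= x, 0 <= y & o ^+ 2 <= x * y].

Lemma psd_of_form (R : realType) (x y o : R) :
  (forall s t : R, 0 <= s ^+ 2 * x + 2 * s * t * o + t ^+ 2 * y) -> psd x y o.
Proof.
move=> form.
have x0 : 0 <= x by have := form 1 0; lra.
have y0 : 0 <= y by have := form 0 1; lra.
(* At [(- o, x)] the form equals [x * (x * y - o ^+ 2)], which settles [x > 0]. If [x = 0], its
   value at [(- (y + 1), o)] is [- o ^+ 2 * (y + 2)], which forces [o = 0]. *)
split=> //; have := form (- o) x; have := form (- (y + 1)) o.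
have [->|xn0] := eqVneq x 0; first by have := mulr_ge0 (sqr_ge0 o) y0; lra.
have x_gt0 : 0 < x by rewrite lt_def xn0.
move=> _ o_x; rewrite -subr_ge0 -(pmulr_rge0 _ x_gt0); lra.
Qed.

(** Real test vectors suffice. *)
Lemma loewner2_sym (R : realType) (x y o x' y' o' : R) :
  loewner2 (cplx (sym x y o)) (cplx (sym x' y' o')) ->
  psd (x' - x) (y' - y) (o' - o).
Proof.
move=> le; apply: psd_of_form => s t.
have := le (\col_i (if i == 0 then s else t)%:C).
rewrite /qform !mulmx2E !mxE !conjc_real /=.
rewrite -!rmorphB /= -!rmorphM /= -!rmorphD /= -!rmorphM /= -!rmorphD /= ler0c; lra.
Qed.

Lemma psd_trace (R : realType) (x y o : R) : psd x y o -> `|o| <= x + y.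
Proof.
case=> x0 y0 oxy; rewrite -ler_sqr ?nnegrE ?addr_ge0 // real_normK ?num_real //.
by have := mulr_ge0 x0 y0; have := sqr_ge0 x; have := sqr_ge0 y; lra.
Qed.

(** The expression is the trace of the product of the two matrices; the cross term is controlled by
    the inequality of arithmetic and geometric means for [x * x'] and [y * y']. *)
Lemma psd_trace_mul (R : realType) (x y o x' y' o' : R) :
  psd x y o -> psd x' y' o' -> 0 <= x * x' + y * y' + 2 * (o * o').
Proof.
case=> x0 y0 oxy [x'0 y'0 o'xy].
have sum0 : 0 <= x * x' + y * y' by rewrite addr_ge0 ?mulr_ge0.
suff : `|2 * (o * o')| <= x * x' + y * y' by rewrite ler_norml; lra.
rewrite -ler_sqr ?nnegrE // real_normK ?num_real //.
have := ler_pM (sqr_ge0 _) (sqr_ge0 _) oxy o'xy.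
by have := sqr_ge0 (x * x' - y * y'); rewrite -!exprMn; lra.
Qed.

(** This is [G - G^2] for [0 <= G <= 1]; its determinant is that of [G] times that of [1 - G]. *)
Lemma psd_sub_sqr (R : realType) (u t v : R) :
  psd u t v -> psd (1 - u) (1 - t) (- v) ->
  psd (u - (u ^+ 2 + v ^+ 2)) (t - (t ^+ 2 + v ^+ 2)) (v - (u + t) * v).
Proof.
case=> u0 t0 v1 [u1 t1]; rewrite sqrrN => v2.
have u2 : 0 <= u - (u ^+ 2 + v ^+ 2).
  (* Bound [v ^+ 2] by [u * t] in the first case and by [(1 - u) * (1 - t)] in the second; either is
     at most [u * (1 - u)]. *)
  by have [?|?] := leP (u + t) 1; nra.
have t2 : 0 <= t - (t ^+ 2 + v ^+ 2).
  by have [?|?] := leP (u + t) 1; nra.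
split=> //.
have := mulr_ge0 (_ : 0 <= u * t - v ^+ 2) (_ : 0 <= (1 - u) * (1 - t) - v ^+ 2).
by rewrite !subr_ge0 => /(_ v1 v2); lra.
Qed.

(* With K := 1 - G, the matrix 1 - G^2 = K + (G - G^2) dominates K, so
   tr (Y - G Y G) = tr (Y (1 - G^2)) >= tr K; and K bounds the entry. *)
Lemma contraction_congr_bound (R : realType) (u t v y1 y2 y3 : R) :
  psd u t v -> psd (1 - u) (1 - t) (- v) -> psd (y1 - 1) (y2 - 1) y3 ->
  forall X, X = sym u t v *m sym y1 y2 y3 *m sym u t v ->
  `|y3 - X 0 1| <= 2 * (y1 + y2) * (y1 + y2 - (X 0 0 + X 1 1)).
Proof.
move=> G0 G1 Y1 X X_def.
have [N1 N2 N3] := psd_sub_sqr G0 G1.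
have [[[u0 t0 _] [u1 t1 v2]] [y1_1 y2_1 _]] := (G0, G1, Y1).
have XE : (X 0 0 = u * (u * y1 + v * y3) + v * (u * y3 + v * y2)) *
          (X 1 1 = v * (v * y1 + t * y3) + t * (v * y3 + t * y2)) *
          (X 0 1 = v * (u * y1 + v * y3) + t * (u * y3 + v * y2)).
  by rewrite X_def !mulmx2E !symE; do !split; ring.
(* Split [Y] as [1 + (Y - 1)]: the second summand has nonnegative trace against both K and
   [G - G^2]. *)
have tr_ge : 2 - u - t <= y1 + y2 - (X 0 0 + X 1 1).
  have := psd_trace_mul Y1 (And3 N1 N2 N3).
  have := psd_trace_mul Y1 G1.
  by rewrite !XE; lra.
have v_le : `|v| <= 2 - u - t.
  by have := psd_trace G1; rewrite normrN; lra.
have y3_le : `|y3| <= y1 + y2 - 2 by have := psd_trace Y1; lra.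
have ut_le : `|1 - u * t - v ^+ 2| <= 2 - u - t.
  by move: (sqr_ge0 v); rewrite ler_norml; nra.
have uy_le : `|u * y1 + t * y2| <= y1 + y2.
  by rewrite ger0_norm; nra.
(* Each of the two products has a factor bounded by the trace of K. *)
have -> : y3 - X 0 1 = y3 * (1 - u * t - v ^+ 2) - v * (u * y1 + t * y2).
  by rewrite XE; ring.
apply: (le_trans (ler_normB _ _)); rewrite !normrM.
have := ler_pM (normr_ge0 _) (normr_ge0 _) y3_le ut_le.
have := ler_pM (normr_ge0 _) (normr_ge0 _) v_le uy_le.
nra.
Qed.

(** * The geometric mean *)

Lemma spec_mul (R : realType) (l1 l2 m1 m2 z w : R) :
  w ^+ 2 = z * (1 - z) ->
  spec l1 l2 z w *m spec m1 m2 z w = spec (l1 * m1) (l2 * m2) z w.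
Proof.
move=> w2; have z2 : z ^+ 2 = z - w ^+ 2 by rewrite w2; ring.
by apply: matrix2P; rewrite mulmx2E !symE; ring: z2.
Qed.

Lemma spec11 (R : realType) (z w : R) : spec 1 1 z w = 1%:M.
Proof. by apply: matrix2P; rewrite !symE !mxE /=; ring. Qed.

Lemma sym_congr (R : realType) (x y o x' y' o' : R) :
  sym x y o *m sym x' y' o' *m sym x y o =
  sym (x ^+ 2 * x' + 2 * x * o * o' + o ^+ 2 * y')
      (o ^+ 2 * x' + 2 * o * y * o' + y ^+ 2 * y')
      (x * o * x' + (x * y + o ^+ 2) * o' + o * y * y').
Proof. by apply: matrix2P; rewrite !mulmx2E !symE; ring. Qed.

(** The form is a trace against the rank-one matrix of the vector [(s, t)]. *)
Lemma psd_form (R : realType) (x y o s t : R) :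
  psd x y o -> 0 <= s ^+ 2 * x + 2 * s * t * o + t ^+ 2 * y.
Proof.
move=> xyo.
have := psd_trace_mul xyo (_ : psd (s ^+ 2) (t ^+ 2) (s * t)).
suff h : psd (s ^+ 2) (t ^+ 2) (s * t) by move=> /(_ h); lra.
by split; rewrite ?sqr_ge0 // exprMn.
Qed.

Lemma psd_congr (R : realType) (x y o x' y' o' : R) :
  psd x' y' o' ->
  exists x'' y'' o'' : R, psd x'' y'' o'' /\
    sym x y o *m sym x' y' o' *m sym x y o = sym x'' y'' o''.
Proof.
move=> psd'; eexists; eexists; eexists; split; last exact: sym_congr.
apply: psd_of_form => s t.
by have := psd_form (s * x + t * o) (s * o + t * y) psd'; lra.
Qed.

Lemma spec_psd (R : realType) (l1 l2 z w : R) :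
  w ^+ 2 = z * (1 - z) -> 0 <= l1 -> 0 <= l2 ->
  psd (l2 + (l1 - l2) * (1 - z)) (l2 + (l1 - l2) * z) ((l1 - l2) * w).
Proof.
move=> w2 l1_0 l2_0; have w2_0 := sqr_ge0 w.
have [z0 z1] : 0 <= z /\ 0 <= 1 - z by split; nra.
split; first by nra.
  by nra.
by rewrite exprMn w2; have := mulr_ge0 l1_0 l2_0; lra.
Qed.

(** If [l2] were negative, a nonnegative determinant [l1 * l2] would give [l1 <= 0], hence a
    negative trace. *)
Lemma psd_spec (R : realType) (x y o l1 l2 z w : R) :
  l2 <= l1 -> w ^+ 2 = z * (1 - z) -> sym x y o = spec l1 l2 z w ->
  psd x y o -> 0 <= l2.
Proof.
move=> le_l w2 E [x0 y0 oxy].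
have [xE yE oE] : [/\ x = l2 + (l1 - l2) * (1 - z), y = l2 + (l1 - l2) * z &
                      o = (l1 - l2) * w].
  split.
  - by have := congr1 (fun M : 'M[R]_2 => M 0 0) E; rewrite !symE.
  - by have := congr1 (fun M : 'M[R]_2 => M 1 1) E; rewrite !symE.
  - by have := congr1 (fun M : 'M[R]_2 => M 0 1) E; rewrite !symE.
have tr_l : x + y = l1 + l2 by rewrite xE yE; ring.
have det_l : x * y - o ^+ 2 = l1 * l2.
  by rewrite xE yE oE exprMn w2; ring.
rewrite leNgt; apply/negP => l2_0; nra.
Qed.

Lemma powR_half_sqr (R : realType) (x : R) :
  0 <= x -> x `^ (1 / 2) * x `^ (1 / 2) = x.
Proof. by move=> x0; rewrite div1r powR12_sqrt // -expr2 sqr_sqrtr. Qed.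

(** With [H = X^(1/2)] and [T = (H^-1 Y^-1 H^-1)^(1/2)], the mean is [G = H T H]. Since [T^2] is
    inverse to [H Y H], also [T (H Y H) T = 1], whence the Riccati equation [G Y G = H H = X]. *)
Lemma gmean_riccati (R : realType) (l1 l2 z w y1 y2 y3 : R) :
  0 < l2 -> l2 <= l1 -> w ^+ 2 = z * (1 - z) ->
  0 < y1 -> 0 < y1 * y2 - y3 ^+ 2 ->
  exists u t v : R, [/\ psd u t v,
    gmean (cplx (spec l1 l2 z w)) (invmx (cplx (sym y1 y2 y3))) =
      cplx (sym u t v) &
    sym u t v *m sym y1 y2 y3 *m sym u t v = spec l1 l2 z w].
Proof.
move=> l2_0 le_l w2 y1_0 det0.
have l1_0 : 0 < l1 by apply: lt_le_trans le_l.
have cplxM (M N : 'M[R]_2) : cplx M *m cplx N = cplx (M *m N).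
  by rewrite /cplx map_mxM.
set Y := sym y1 y2 y3; set X := spec l1 l2 z w.
pose d := y1 * y2 - y3 ^+ 2.
have d_neq0 : d != 0 by rewrite gt_eqF.
pose V := sym (y2 / d) (y1 / d) (- y3 / d).
have VY : V *m Y = 1%:M.
  by apply: matrix2P; rewrite mulmx2E !symE !mxE /= /d; field; rewrite d_neq0.
have V_psd : psd (y2 / d) (y1 / d) (- y3 / d).
  have y2_0 : 0 < y2 by rewrite -(pmulr_rgt0 _ y1_0); have := sqr_ge0 y3; lra.
  split; try by rewrite divr_ge0 // ltW.
  rewrite -subr_ge0; have -> : y2 / d * (y1 / d) - (- y3 / d) ^+ 2 = d^-1.
    by rewrite /d; field.
  by rewrite invr_ge0 ltW.
have invY : invmx (cplx Y) = cplx V.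
  have unitY : cplx Y \in unitmx.
    apply: (proj2 (mulmx1_unit (_ : cplx V *m cplx Y = 1%:M))).
    by rewrite cplxM VY /cplx map_mx1.
  rewrite -[LHS]mul1mx; have <- : cplx V *m cplx Y = 1%:M.
    by rewrite cplxM VY /cplx map_mx1.
  by rewrite mulmxK.
pose H := spec (l1 `^ (1 / 2)) (l2 `^ (1 / 2)) z w.
pose H' := spec (l1 `^ (- (1 / 2))) (l2 `^ (- (1 / 2))) z w.
have HH : H *m H = X by rewrite spec_mul // !powR_half_sqr // ltW.
have H'H : H' *m H = 1%:M.
  rewrite spec_mul // !powRN !mulVf ?spec11 // gt_eqF // powR_gt0 //.
have [z1 [z2 [z3 [Z_psd ZE]]]] := psd_congr
  (l2 `^ (- (1 / 2)) + (l1 `^ (- (1 / 2)) - l2 `^ (- (1 / 2))) * (1 - z))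
  (l2 `^ (- (1 / 2)) + (l1 `^ (- (1 / 2)) - l2 `^ (- (1 / 2))) * z)
  ((l1 `^ (- (1 / 2)) - l2 `^ (- (1 / 2))) * w) V_psd.
have {}ZE : H' *m V *m H' = sym z1 z2 z3 by [].
(* The congruence [H' V H'] has eigenvectors of its own, so its square root needs a new spectral
   form. *)
have [m1 [m2 [z' [w' [le_m w'2 ZS]]]]] := spec_decomposition z1 z2 z3.
have m2_0 := psd_spec le_m w'2 ZS Z_psd.
have m1_0 := le_trans m2_0 le_m.
pose T := spec (m1 `^ (1 / 2)) (m2 `^ (1 / 2)) z' w'.
have TT : T *m T = H' *m V *m H'.
  by rewrite spec_mul // !powR_half_sqr // ZE ZS.
have [u [t [v [G_psd GE]]]] := psd_congr
  (l2 `^ (1 / 2) + (l1 `^ (1 / 2) - l2 `^ (1 / 2)) * (1 - z))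
  (l2 `^ (1 / 2) + (l1 `^ (1 / 2) - l2 `^ (1 / 2)) * z)
  ((l1 `^ (1 / 2) - l2 `^ (1 / 2)) * w)
  (spec_psd w'2 (powR_ge0 m1 (1 / 2)) (powR_ge0 m2 (1 / 2))).
have {}GE : H *m T *m H = sym u t v by [].
exists u, t, v; split=> //.
  rewrite /gmean invY /mpow !mfun_spec // !cplxM -/H -/H' ZE ZS mfun_spec //.
  by rewrite !cplxM -/T GE.
have TTW : T *m (T *m (H *m Y *m H)) = 1%:M.
  rewrite mulmxA TT -!mulmxA (mulmxA H' H) H'H mul1mx (mulmxA V) VY mul1mx.
  exact: H'H.
have TWT : T *m (H *m Y *m H) *m T = 1%:M by apply: mulmx1C.
rewrite -GE -HH -[RHS](_ : H *m (T *m (H *m Y *m H) *m T) *m H = _).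
  by rewrite !mulmxA.
by rewrite TWT mulmx1.
Qed.

(** * Behaviour near zero *)

Lemma derivable1_comp (R : realType) (f g : R -> R) (x : R) :
  derivable f (g x) 1 -> derivable g x 1 -> derivable (f \o g) x 1.
Proof.
move=> /derivable1_diffP df /derivable1_diffP dg.
exact/derivable1_diffP/differentiable_comp.
Qed.

Lemma derivable1_continuous (R : realType) (f : R -> R) (x : R) :
  derivable f x 1 -> {for x, continuous f}.
Proof. by move=> /derivable1_diffP /differentiable_continuous. Qed.

(** Near zero [F z] is below a multiple of [z], while the right side is above a positive multiple of
    [sqrt z]. *)
Lemma derivable1_lt_sqrt (R : realType) (F f : R -> R) :
  derivable F 0 1 -> F 0 = 0 -> {for 0, continuous f} -> f 0 != 0 ->
  \forall z \near 0^'+, F z < Num.sqrt (z * (1 - z)) * `|f z|.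
Proof.
move=> dF F0 cf f0.
have [c c0 c_lt] : exists2 c : R, 0 < c & c < `|f 0|.
  by exists (`|f 0| / 2); move: f0; rewrite -normr_gt0; lra.
have f_gt : \forall z \near 0^'+, c < `|f z|.
  have cvg_f : (fun z => `|f z|) z @[z --> 0^'+] --> `|f 0|.
    by apply: cvg_at_right_filter; apply: cvg_norm; exact: cf.
  exact: (cvgr_gt _ cvg_f).
pose M := `|'D_1 F 0| + 1.
have M0 : 0 < M by have := normr_ge0 ('D_1 F 0); rewrite /M; lra.
have F_lt : \forall z \near 0^'+, F z < M * z.
  have cvg_F : (fun h => h^-1 *: (F (h *: 1 + 0) - F 0)) h @[h --> 0^'+] --> 'D_1 F 0.
    exact: cvg_dnbhs_at_right dF.
  have : \forall z \near 0^'+, z^-1 *: (F (z *: 1 + 0) - F 0) < M.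
    apply: (cvgr_lt _ cvg_F).
    by have := ler_norm ('D_1 F 0); rewrite /M; lra.
  move=> lt_M; near=> z.
  have z0 : 0 < z by near: z; exact: nbhs_right_gt.
  have : z^-1 *: (F (z *: 1 + 0) - F 0) < M by near: z.
  by rewrite F0 subr0 addr0 /GRing.scale /= mulr1 mulrC ltr_pdivrMr.
(* Below this threshold and below [1 / 2], [(M z)^2 <= z c^2 / 2 <= z (1 - z) c^2]. *)
have cM : 0 < c ^+ 2 / (2 * M ^+ 2).
  by apply: divr_gt0; [|apply: mulr_gt0 => //]; apply: exprn_gt0.
near=> z.
have z0 : 0 < z by near: z; exact: nbhs_right_gt.
have z1 : z < 1 / 2 by near: z; apply: nbhs_right_lt.
have zM : z < c ^+ 2 / (2 * M ^+ 2).
  by near: z; exact: nbhs_right_lt.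
have F_z : F z < M * z by near: z.
have f_z : c < `|f z| by near: z.
apply: (lt_le_trans F_z); apply: (@le_trans _ _ (Num.sqrt (z * (1 - z)) * c)); last first.
  by rewrite ler_wpM2l ?sqrtr_ge0 // ltW.
have zz0 : 0 <= z * (1 - z) by nra.
have [Mz0 wc0] : 0 <= M * z /\ 0 <= Num.sqrt (z * (1 - z)) * c.
  by split; apply: mulr_ge0; rewrite ?sqrtr_ge0 // ltW.
rewrite -ler_sqr // !exprMn sqr_sqrtr //.
move: zM; rewrite ltr_pdivlMr ?mulr_gt0 ?exprn_gt0 // => {}zM.
have : z * (z * (2 * M ^+ 2)) <= z * c ^+ 2 by rewrite ler_pM2l // ltW.
have : z * (1 / 2) * c ^+ 2 <= z * (1 - z) * c ^+ 2.
  by rewrite ler_wpM2r ?sqr_ge0 // ler_pM2l //; lra.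
lra.
Unshelve. all: by end_near.
Qed.

(* The two eigenvalues ([e = 1] and [e = -1]) of a matrix of trace [L + 1 - b z]
   and determinant [L + d z]. *)
Definition eigval {R : realType} (e L b d z : R) : R :=
  (L + 1 - b * z + e * Num.sqrt ((L + 1 - b * z) ^+ 2 - 4 * (L + d * z))) / 2.

(* Pointwise restatements: unification does not see the library lemmas, stated
   for the function operations [f + g] and [f * g], through a lambda. *)
Lemma derivable1D (R : realType) (f g : R -> R) (x : R) :
  derivable f x 1 -> derivable g x 1 -> derivable (fun z => f z + g z) x 1.
Proof. exact: derivableD. Qed.

Lemma derivable1M (R : realType) (f g : R -> R) (x : R) :
  derivable f x 1 -> derivable g x 1 -> derivable (fun z => f z * g z) x 1.
Proof. exact: derivableM. Qed.

Lemma derivable1B (R : realType) (f g : R -> R) (x : R) :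
  derivable f x 1 -> derivable g x 1 -> derivable (fun z => f z - g z) x 1.
Proof. exact: derivableB. Qed.

Lemma derivable1_affine (R : realType) (c e x : R) :
  derivable (fun z => c + e * z) x 1.
Proof.
apply: derivable1D; first exact: derivable_cst.
by apply: derivable1M; [exact: derivable_cst | exact: derivable_id].
Qed.

(** At zero the discriminant is [(L - 1) ^+ 2 > 0], where the square root is differentiable. *)
Lemma derivable_eigval (R : realType) (e L b d : R) : 1 < L ->
  derivable (eigval e L b d) 0 1.
Proof.
move=> L1.
have dT : derivable (fun z => L + 1 - b * z) 0 1.
  by under eq_fun do rewrite -mulNr; exact: derivable1_affine.
have dD : derivable (fun z => (L + 1 - b * z) ^+ 2 - 4 * (L + d * z)) 0 1.
  apply: derivable1B; first by under eq_fun do rewrite expr2; exact: derivable1M.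
  apply: derivable1M; first exact: derivable_cst.
  exact: derivable1_affine.
apply: derivable1M; last exact: derivable_cst.
apply: derivable1D; first exact: dT.
apply: derivable1M; first exact: derivable_cst.
apply: (@derivable1_comp _ (@Num.sqrt R)); last exact: dD.
rewrite !mulr0; apply: ex_derive; apply: is_derive1_sqrt.
by have := exprn_gt0 2 (_ : 0 < L - 1); rewrite subr_gt0 => /(_ L1); lra.
Qed.

Lemma eigval0 (R : realType) (L b d : R) : 1 < L ->
  eigval 1 L b d 0 = L /\ eigval (- 1) L b d 0 = 1.
Proof.
move=> L1; rewrite /eigval !mulr0 subr0 addr0.
have -> : (L + 1) ^+ 2 - 4 * L = (L - 1) ^+ 2 by ring.
by rewrite sqrtr_sqr ger0_norm; [split; field | lra].
Qed.

(** The trace of [f] applied to the matrix with these eigenvalues. *)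
Definition eigsum {R : realType} (f : R -> R) (L b d z : R) : R :=
  f (eigval 1 L b d z) + f (eigval (- 1) L b d z).

(** The divided difference of [f] at the eigenvalues: applying [f] to the matrix multiplies its
    off-diagonal entry by it. *)
Definition eigslope {R : realType} (f : R -> R) (L b d z : R) : R :=
  (f (eigval 1 L b d z) - f (eigval (- 1) L b d z)) /
  (eigval 1 L b d z - eigval (- 1) L b d z).

Lemma derivable_eigsum (R : realType) (f : R -> R) (L b d : R) : 1 < L ->
  derivable f L 1 -> derivable f 1 1 ->
  derivable (eigsum f L b d) 0 1 /\ derivable (eigslope f L b d) 0 1.
Proof.
move=> L1 dfL df1; have [e1 e2] := eigval0 b d L1.
have d1 : derivable (fun z => f (eigval 1 L b d z)) 0 1.
  by apply: derivable1_comp; [rewrite e1 | exact: derivable_eigval].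
have d2 : derivable (fun z => f (eigval (- 1) L b d z)) 0 1.
  by apply: derivable1_comp; [rewrite e2 | exact: derivable_eigval].
split; first exact: (derivable1D d1 d2).
apply: derivable1M; first exact: (derivable1B d1 d2).
apply: derivableV; last by apply: derivable1B; exact: derivable_eigval.
by rewrite e1 e2 subr_eq0 gt_eqF.
Qed.

Lemma eigval_near (R : realType) (L b d : R) : 1 < L ->
  \forall z \near 0^'+,
    0 < eigval (- 1) L b d z /\ eigval (- 1) L b d z < eigval 1 L b d z.
Proof.
move=> L1; have [e1 e2] := eigval0 b d L1.
have cvg_eig e : eigval e L b d z @[z --> 0^'+] --> eigval e L b d 0.
  apply: cvg_at_right_filter; apply: derivable1_continuous.
  exact: derivable_eigval.
pose m := (L + 1) / 2.
have m1 : eigval (- 1) L b d 0 < m by rewrite e2 /m; lra.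
have m2 : m < eigval 1 L b d 0 by rewrite e1 /m; lra.
have p2 : 0 < eigval (- 1) L b d 0 by rewrite e2.
near=> z; split; first by near: z; apply: (cvgr_gt _ (cvg_eig _)).
apply: (@lt_trans _ _ m); near: z.
  exact: (cvgr_lt _ (cvg_eig _)).
exact: (cvgr_gt _ (cvg_eig _)).
Unshelve. all: by end_near.
Qed.

Lemma eigval_vieta (R : realType) (L b d z : R) :
  eigval (- 1) L b d z < eigval 1 L b d z ->
  eigval 1 L b d z + eigval (- 1) L b d z = L + 1 - b * z /\
  eigval 1 L b d z * eigval (- 1) L b d z = L + d * z.
Proof.
rewrite /eigval; set D := _ - 4 * _; set s := Num.sqrt D => lt_e.
(* [Num.sqrt] is 0 on negative reals; strictly ordered eigenvalues exclude that case. *)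
have s0 : 0 < s by lra.
have s2 : s ^+ 2 = D by rewrite sqr_sqrtr // ltW // -sqrtr_gt0.
by split; [field | move: s2; rewrite /D => s2; field: s2].
Qed.

(** At [z = 0] both traces are [s + t], while the off-diagonal coefficients differ by the nonzero
    [(s - t) * (k' / (M - 1) - k / (L - 1))]. The weight [K] accommodates the trace factor in the
    near-order bound. *)
Lemma eigsum_lt_offdiag (R : realType) (L M b d b' d' s t k k' : R)
    (f g K : R -> R) :
  1 < L -> 1 < M ->
  derivable f L 1 -> derivable f 1 1 -> derivable g M 1 -> derivable g 1 1 ->
  f L = s -> f 1 = t -> g M = s -> g 1 = t -> s != t ->
  k / (L - 1) != k' / (M - 1) -> derivable K 0 1 ->
  \forall z \near 0^'+,
    K z * (eigsum g M b' d' z - eigsum f L b d z) <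
    Num.sqrt (z * (1 - z)) * `|k' * eigslope g M b' d' z - k * eigslope f L b d z|.
Proof.
move=> L1 M1 dfL df1 dgM dg1 fL f1 gM g1 st kk dK.
have [[dfs dfl] [dgs dgl]] := (derivable_eigsum b d L1 dfL df1,
                               derivable_eigsum b' d' M1 dgM dg1).
have [[eL eL1] [eM eM1]] := (eigval0 b d L1, eigval0 b' d' M1).
apply: derivable1_lt_sqrt.
- by apply: derivable1M; [exact: dK | exact: (derivable1B dgs dfs)].
- by rewrite /eigsum eL eL1 eM eM1 fL f1 gM g1 subrr mulr0.
- apply: derivable1_continuous.
  have dk (c : R) (h : R -> R) : derivable h 0 1 -> derivable (fun z => c * h z) 0 1.
    by move=> dh; apply: derivable1M; [exact: derivable_cst | exact: dh].
  exact: (derivable1B (dk k' _ dgl) (dk k _ dfl)).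
rewrite /eigslope eL eL1 eM eM1 fL f1 gM g1.
have -> : k' * ((s - t) / (M - 1)) - k * ((s - t) / (L - 1)) =
          (s - t) * (k' / (M - 1) - k / (L - 1)) by ring.
by rewrite mulf_neq0 // subr_eq0 // eq_sym.
Qed.

(** * Order relations between spectral forms *)

Lemma posdef2_sym (R : realType) (x y o : R) :
  0 < x -> 0 < x * y - o ^+ 2 -> posdef2 (cplx (sym x y o)).
Proof.
move=> x0 det0; split.
  by apply: matrix2P; rewrite !mxE conjc_real.
move=> v v_neq0.
(* The factor [x > 0] allows completing the square without division. *)
have form_ge0 s t : 0 <= x * (s ^+ 2 * x + 2 * s * t * o + t ^+ 2 * y).
  have -> : x * (s ^+ 2 * x + 2 * s * t * o + t ^+ 2 * y) =
            (x * s + o * t) ^+ 2 + (x * y - o ^+ 2) * t ^+ 2 by ring.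
  by rewrite addr_ge0 ?sqr_ge0 // mulr_ge0 ?sqr_ge0 // ltW.
have form_eq0 s t : x * (s ^+ 2 * x + 2 * s * t * o + t ^+ 2 * y) = 0 ->
    s = 0 /\ t = 0.
  have -> : x * (s ^+ 2 * x + 2 * s * t * o + t ^+ 2 * y) =
            (x * s + o * t) ^+ 2 + (x * y - o ^+ 2) * t ^+ 2 by ring.
  move/eqP; rewrite paddr_eq0 ?sqr_ge0 //; last by rewrite mulr_ge0 ?sqr_ge0 // ltW.
  rewrite sqrf_eq0 mulf_eq0 (gt_eqF det0) sqrf_eq0 /= => /andP[xs /eqP t0].
  by move: xs; rewrite t0 mulr0 addr0 mulf_eq0 (gt_eqF x0) /= => /eqP->.
have [a [b v0E]] : exists a b, v 0 0 = a +i* b by case: (v 0 0) => a b; exists a, b.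
have [c [d v1E]] : exists c d, v 1 0 = c +i* d by case: (v 1 0) => c d; exists c, d.
(* For a real symmetric matrix, the real and imaginary parts of the vector contribute separately. *)
have -> : qform (cplx (sym x y o)) v =
    ((a ^+ 2 * x + 2 * a * c * o + c ^+ 2 * y) +
     (b ^+ 2 * x + 2 * b * d * o + d ^+ 2 * y))%:C.
  rewrite /qform !mulmx2E !mxE v0E v1E /=; simpc.
  by apply/eqP; rewrite eq_complex /=; apply/andP; split; apply/eqP; ring.
rewrite ltcR -(pmulr_rgt0 _ x0) mulrDr lt_def addr_ge0 // andbT.
rewrite paddr_eq0 //; apply: contra v_neq0.
move=> /andP[/eqP/form_eq0[a0 c0] /eqP/form_eq0[b0 d0]].
apply/eqP/matrixP => i j; rewrite !ord1 !mxE.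
case: i => [[|[|i]] lt_i] //.
  rewrite (_ : Ordinal lt_i = 0); last exact: val_inj.
  by rewrite v0E a0 b0.
rewrite (_ : Ordinal lt_i = 1); last exact: val_inj.
by rewrite v1E c0 d0.
Qed.

Lemma sym_eig (R : realType) (x y o l1 l2 : R) :
  l2 < l1 -> l1 + l2 = x + y -> l1 * l2 = x * y - o ^+ 2 ->
  sym x y o = spec l1 l2 ((y - l2) / (l1 - l2)) (o / (l1 - l2)) /\
  (o / (l1 - l2)) ^+ 2 =
    (y - l2) / (l1 - l2) * (1 - (y - l2) / (l1 - l2)).
Proof.
move=> lt_l tr_l det_l; have l_neq0 : l1 - l2 != 0 by rewrite subr_eq0 gt_eqF.
have xE : x = l1 + l2 - y by rewrite tr_l; ring.
have o2 : o ^+ 2 = x * y - l1 * l2 by rewrite det_l; ring.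
split; first by apply: matrix2P; rewrite !symE ?xE; field.
by rewrite expr_div_n o2 xE; field.
Qed.

Lemma near2_bound (R : realType) (l1 l2 z w y1 y2 y3 : R) :
  0 < l2 -> l2 <= l1 -> w ^+ 2 = z * (1 - z) -> psd (y1 - 1) (y2 - 1) y3 ->
  near2 (cplx (spec l1 l2 z w)) (cplx (sym y1 y2 y3)) ->
  `|y3 - (l1 - l2) * w| <= 2 * (y1 + y2) * (y1 + y2 - (l1 + l2)).
Proof.
move=> l2_0 le_l w2 Y1; have [y1_1 y2_1 y3_le] := Y1.
have y1_0 : 0 < y1 by lra.
have det0 : 0 < y1 * y2 - y3 ^+ 2 by lra.
have [u [t [v [G0 GE XE]]]] := gmean_riccati l2_0 le_l w2 y1_0 det0.
rewrite /near2 GE.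
have -> : 1%:M = cplx (sym 1 1 0) :> 'M[R[i]]_2.
  by apply: matrix2P; rewrite !mxE.
move=> /loewner2_sym; rewrite sub0r => G1.
have := contraction_congr_bound G0 G1 Y1 (esym XE).
rewrite !symE.
by have -> : l2 + (l1 - l2) * (1 - z) + (l2 + (l1 - l2) * z) = l1 + l2 by ring.
Qed.

(** The matrix whose power [1 / p] is [Rap]. *)
Lemma diag_congr_spec (R : realType) (x y z w : R) :
  spec x 1 0 0 *m spec y 1 z w *m spec x 1 0 0 =
  sym (x ^+ 2 * (1 + (y - 1) * (1 - z))) (1 + (y - 1) * z) (x * (y - 1) * w).
Proof. by rewrite sym_congr; congr sym; ring. Qed.

(** The matrix whose power [1 / q] is [Aaq], with [y] standing for [a^q]. *)
Lemma mean_spec (R : realType) (alpha y z w : R) :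
  (1 - alpha)%:C *: cplx (spec y 1 0 0) + alpha%:C *: cplx (spec y 1 z w) =
  cplx (sym (y - alpha * (y - 1) * z) (1 + alpha * (y - 1) * z)
            (alpha * (y - 1) * w)).
Proof.
rewrite /cplx -!map_mxZ -map_mxD; congr map_mx.
by apply: matrix2P; rewrite !mxE /=; ring.
Qed.

Lemma not_loewner2_spec (R : realType) (l1 l2 z w m1 m2 z' w' : R) :
  m1 + m2 - (l1 + l2) < `|(m1 - m2) * w' - (l1 - l2) * w| ->
  ~ loewner2 (cplx (spec l1 l2 z w)) (cplx (spec m1 m2 z' w')).
Proof.
by move=> lt_off /loewner2_sym /psd_trace; lra.
Qed.

Lemma posdef2_spec (R : realType) (l1 l2 z w : R) :
  0 < l2 -> l2 <= l1 -> w ^+ 2 = z * (1 - z) ->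
  posdef2 (cplx (spec l1 l2 z w)).
Proof.
move=> l2_0 le_l w2; have w2_0 := sqr_ge0 w.
have z1 : 0 <= 1 - z by nra.
apply: posdef2_sym; first by nra.
have l1_0 : 0 < l1 by apply: lt_le_trans le_l.
by rewrite exprMn w2; have := mulr_gt0 l1_0 l2_0; lra.
Qed.

(** Both the product and the sum of [m1 - 1] and [m2 - 1] are nonnegative, being [c] and [Q - 1]. *)
Lemma ge1_of_sum_prod (R : realType) (m1 m2 Q c : R) :
  m2 <= m1 -> 1 <= Q -> 0 <= c -> m1 + m2 = Q + 1 -> m1 * m2 = Q + c ->
  1 <= m2.
Proof.
move=> le_m Q1 c0 sum prod; rewrite leNgt; apply/negP => m2_lt1.
have : (m1 - 1) * (m2 - 1) = c by have := prod; lra.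
nra.
Qed.

Lemma derivable1_powR (R : realType) (r x : R) :
  0 < x -> derivable (fun t : R => t `^ r) x 1.
Proof. by move=> x0; apply: derivable_powR; rewrite in_itv /= x0. Qed.

Lemma derivable1_ln_powR (R : realType) (r x : R) :
  0 < x -> derivable (fun t : R => ln (t `^ r)) x 1.
Proof.
move=> x0; apply: (@derivable1_comp _ (@ln R)); last exact: derivable1_powR.
by apply: ex_derive; apply: is_derive1_ln; rewrite powR_gt0.
Qed.

(** * The pair of matrices and the choice of a small angle *)

Theorem theorem4p8 (R : realType) (alpha p q : R) :
  0 < alpha -> alpha < 1 -> 0 < p -> 0 < q ->
  exists A B : 'M[R[i]]_2,
    posdef2 A /\ posdef2 B /\
    ~ near2 (Rap alpha p A B) (Aaq alpha q A B) /\
    ~ loewner2 (Rap alpha p A B) (Aaq alpha q A B) /\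
    ~ chao2 (Rap alpha p A B) (Aaq alpha q A B).
Proof.
move=> alpha0 alpha1 p0 q0.
pose e := (1 - alpha) / 2 * p.
have e0 : 0 < e by rewrite /e !mulr_gt0 ?subr_gt0 ?invr_gt0 ?ltr0n.
pose x := alpha^-1.
have x1 : 1 < x by rewrite /x invf_gt1.
have [a a1 xE] : exists2 a : R, 1 < a & a `^ e = x.
  exists (x `^ e^-1); last first.
    by rewrite -powRrM mulVf ?gt_eqF // powRr1 // ltW // (lt_trans ltr01).
  rewrite -[1](congr1 (@^~ e^-1) (powR1 R)) gt0_ltr_powR ?invr_gt0 ?nnegrE //.
  by rewrite ltW // (lt_trans ltr01).
have a0 : 0 < a by exact: lt_trans a1.
have powR_gt1 r : 0 < r -> 1 < a `^ r.
  move=> r0; rewrite -[1](congr1 (@^~ r) (powR1 R)) gt0_ltr_powR ?nnegrE //.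
  exact: ltW.
pose y := a `^ (alpha * p).
have y1 : 1 < y by rewrite powR_gt1 // mulr_gt0.
pose L := a `^ p; have L1 : 1 < L by exact: powR_gt1.
pose Q := a `^ q; have Q1 : 1 < Q by exact: powR_gt1.
(* The exponents add up: [2 * e + alpha * p = p]. *)
have L_def : L = x ^+ 2 * y.
  have aD r s : a `^ (r + s) = a `^ r * a `^ s.
    by rewrite powRD //; apply/implyP => _; rewrite gt_eqF.
  rewrite /L /y -xE expr2 -!aD.
  by congr (_ `^ _); rewrite /e; field.
(* [a] is chosen so that [x = 1 / alpha]; then [x (y - 1) < alpha (x^2 y - 1)]
   reduces to [1 < x^2]. *)
have slope_neq : x * (y - 1) / (L - 1) != alpha * (Q - 1) / (Q - 1).
  have alphaK : x * alpha = 1 by rewrite /x mulVf ?gt_eqF.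
  have Q_neq0 : Q - 1 != 0 by rewrite subr_eq0 gt_eqF.
  have x0 : 0 < x by lra.
  rewrite mulfK // lt_eqF // ltr_pdivrMr ?subr_gt0 //.
  by rewrite -(ltr_pM2l x0) [X in _ < X]mulrA alphaK mul1r L_def; nra.
(* The matrix under the power [1 / p] has trace [L + 1 - bC * z] and determinant [L]; the one under
   [1 / q] has trace [Q + 1] and determinant [Q + dE * z]. *)
pose bC := (x ^+ 2 - 1) * (y - 1).
pose dE := (Q - 1) ^+ 2 * alpha * (1 - alpha).
have Lp : L `^ (1 / p) = a.
  by rewrite /L -powRrM mulrC div1r mulVf ?gt_eqF // powRr1 // ltW.
have Qq : Q `^ (1 / q) = a.
  by rewrite /Q -powRrM mulrC div1r mulVf ?gt_eqF // powRr1 // ltW.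
have one r : 1 `^ r = 1 :> R by rewrite powR1.
have [L0 Q0] : 0 < L /\ 0 < Q by split; exact: (lt_trans ltr01).
have a_neq1 : a != 1 by rewrite gt_eqF.
have lna_neq0 : ln a != 0 by rewrite gt_eqF // ln_gt0.
pose f := fun t : R => t `^ (1 / p).
pose g := fun t : R => t `^ (1 / q).
have pow_near K := @eigsum_lt_offdiag R L Q bC 0 0 dE a 1
  (x * (y - 1)) (alpha * (Q - 1)) f g K L1 Q1
  (derivable1_powR L0) (derivable1_powR ltr01)
  (derivable1_powR Q0) (derivable1_powR ltr01)
  Lp (one _) Qq (one _) a_neq1 slope_neq.
have ln_near K := @eigsum_lt_offdiag R L Q bC 0 0 dE (ln a) 0
  (x * (y - 1)) (alpha * (Q - 1)) (fun t => ln (f t)) (fun t => ln (g t)) K L1 Q1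
  (derivable1_ln_powR L0) (derivable1_ln_powR ltr01)
  (derivable1_ln_powR Q0) (derivable1_ln_powR ltr01)
  (congr1 (@ln R) Lp) (etrans (congr1 (@ln R) (one _)) (ln1 R))
  (congr1 (@ln R) Qq) (etrans (congr1 (@ln R) (one _)) (ln1 R))
  lna_neq0 slope_neq.
have dcst1 : derivable (fun _ : R => 1 : R) 0 1 by exact: derivable_cst.
have dK : derivable (fun z => 2 * eigsum g Q 0 dE z) 0 1.
  apply: derivable1M; first exact: derivable_cst.
  by have [] := @derivable_eigsum R g Q 0 dE Q1 (derivable1_powR Q0)
    (derivable1_powR ltr01).
have lt1 : \forall z \near (0 : R)^'+, 0 < z < 1.
  near=> z; apply/andP; split; near: z; [exact: nbhs_right_gt | exact: nbhs_right_lt].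
have [z [z01 [l2_0 lt_l] [m2_0 lt_m] [lt_near lt_loewner lt_chao]]] : exists z,
    [/\ 0 < z < 1,
        0 < eigval (- 1) L bC 0 z /\ eigval (- 1) L bC 0 z < eigval 1 L bC 0 z,
        0 < eigval (- 1) Q 0 dE z /\ eigval (- 1) Q 0 dE z < eigval 1 Q 0 dE z &
    [/\ 2 * eigsum g Q 0 dE z * (eigsum g Q 0 dE z - eigsum f L bC 0 z) <
          Num.sqrt (z * (1 - z)) * `|alpha * (Q - 1) * eigslope g Q 0 dE z -
                                     x * (y - 1) * eigslope f L bC 0 z|,
        1 * (eigsum g Q 0 dE z - eigsum f L bC 0 z) <
          Num.sqrt (z * (1 - z)) * `|alpha * (Q - 1) * eigslope g Q 0 dE z -
                                     x * (y - 1) * eigslope f L bC 0 z| &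
        1 * (eigsum (fun t => ln (g t)) Q 0 dE z -
             eigsum (fun t => ln (f t)) L bC 0 z) <
          Num.sqrt (z * (1 - z)) *
          `|alpha * (Q - 1) * eigslope (fun t => ln (g t)) Q 0 dE z -
            x * (y - 1) * eigslope (fun t => ln (f t)) L bC 0 z|]].
  (* One small [z] serves all three orders at once. *)
  near (0 : R)^'+ => z; exists z; split.
  - by near: z.
  - by near: z; exact: eigval_near.
  - by near: z; exact: eigval_near.
  - split; near: z; [exact: pow_near dK | exact: pow_near dcst1 | exact: ln_near dcst1].
have /andP[z0 z1] := z01.
pose w := Num.sqrt (z * (1 - z)).
have w2 : w ^+ 2 = z * (1 - z) by rewrite sqr_sqrtr // mulr_ge0 ?subr_ge0 // ltW.
have zero2 : 0 ^+ 2 = 0 * (1 - 0) :> R by rewrite expr0n mul0r.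
have [lsum lprod] := eigval_vieta lt_l.
have [msum mprod] := eigval_vieta lt_m.
rewrite /eigsum /eigslope in lt_near lt_loewner lt_chao.
set l1 := eigval 1 L bC 0 z in l2_0 lt_l lsum lprod lt_near lt_loewner lt_chao.
set l2 := eigval (- 1) L bC 0 z in l2_0 lt_l lsum lprod lt_near lt_loewner lt_chao.
set m1 := eigval 1 Q 0 dE z in m2_0 lt_m msum mprod lt_near lt_loewner lt_chao.
set m2 := eigval (- 1) Q 0 dE z in m2_0 lt_m msum mprod lt_near lt_loewner lt_chao.
clearbody l1 l2 m1 m2.
pose A := spec a 1 0 0; pose B := spec a 1 z w.
have mpowA r : 0 < r -> mpow (cplx A) r = cplx (spec (a `^ r) 1 0 0).
  by move=> r0; rewrite /mpow mfun_spec ?one // ltW.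
have mpowB r : 0 < r -> mpow (cplx B) r = cplx (spec (a `^ r) 1 z w).
  by move=> r0; rewrite /mpow mfun_spec ?one // ltW.
have [CE wC2] := @sym_eig R (x ^+ 2 * (1 + (y - 1) * (1 - z)))
  (1 + (y - 1) * z) (x * (y - 1) * w) l1 l2 lt_l
  ltac:(rewrite lsum L_def /bC; ring)
  ltac:(rewrite lprod L_def exprMn w2; ring).
have [EE wE2] := @sym_eig R (Q - alpha * (Q - 1) * z)
  (1 + alpha * (Q - 1) * z) (alpha * (Q - 1) * w) m1 m2 lt_m
  ltac:(rewrite msum; ring)
  ltac:(rewrite mprod exprMn w2 /dE; ring).
set zC := (_ / (l1 - l2)) in CE wC2; set wC := (_ / (l1 - l2)) in CE wC2.
set zE := (_ / (m1 - m2)) in EE wE2; set wE := (_ / (m1 - m2)) in EE wE2.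
have RapE : Rap alpha p (cplx A) (cplx B) = cplx (spec (f l1) (f l2) zC wC).
  rewrite /Rap mpowA // mpowB ?mulr_gt0 // -/e xE -/y /cplx -!map_mxM.
  by rewrite diag_congr_spec CE -/(cplx _) /mpow mfun_spec // ltW.
have AaqE : Aaq alpha q (cplx A) (cplx B) = cplx (spec (g m1) (g m2) zE wE).
  by rewrite /Aaq mpowA // mpowB // -/Q mean_spec EE /mpow mfun_spec // ltW.
(* Off-diagonal entries are rewritten as [w] times a coefficient times a divided difference, the
   shape of the estimates at the chosen [z]. *)
have offC (h : R -> R) : (h l1 - h l2) * wC =
    w * (x * (y - 1) * ((h l1 - h l2) / (l1 - l2))) by rewrite /wC; ring.
have offE (h : R -> R) : (h m1 - h m2) * wE =
    w * (alpha * (Q - 1) * ((h m1 - h m2) / (m1 - m2))) by rewrite /wE; ring.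
have off_norm u v : `|w * u - w * v| = w * `|u - v|.
  by rewrite -mulrBr normrM ger0_norm // sqrtr_ge0.
have [l1_0 m1_0] := (lt_trans l2_0 lt_l, lt_trans m2_0 lt_m).
have le_f : f l2 <= f l1.
  by apply: ge0_ler_powR; rewrite ?nnegrE ltW // divr_gt0.
have le_g : g m2 <= g m1.
  by apply: ge0_ler_powR; rewrite ?nnegrE ltW // divr_gt0.
exists (cplx A), (cplx B); rewrite RapE AaqE; split; [|split; [|split; [|split]]].
- exact: posdef2_spec ltr01 (ltW a1) zero2.
- exact: posdef2_spec ltr01 (ltW a1) w2.
- move=> le_near.
  (* The near-order bound requires [1 <= Y], that is [1 <= g m2]. *)
  have m2_1 : 1 <= m2.
    have dE0 : 0 <= dE * z.
      by rewrite /dE !mulr_ge0 ?sqr_ge0 ?subr_ge0 // ltW.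
    apply: (ge1_of_sum_prod (ltW lt_m) (ltW Q1) dE0); last by rewrite mprod.
    by rewrite msum mul0r subr0.
  have g2_1 : 1 <= g m2.
    have q_ge0 : 0 <= 1 / q by rewrite divr_ge0 // ltW.
    rewrite -[X in X <= _](one (1 / q)).
    by apply: ge0_ler_powR => //; rewrite nnegrE ltW.
  have Y1 : psd (g m2 + (g m1 - g m2) * (1 - zE) - 1)
                (g m2 + (g m1 - g m2) * zE - 1) ((g m1 - g m2) * wE).
    have := @spec_psd R (g m1 - 1) (g m2 - 1) zE wE wE2.
    rewrite !subr_ge0 => /(_ (le_trans g2_1 le_g) g2_1).
    by congr psd; ring.
  have := near2_bound (powR_gt0 _ l2_0) le_f wC2 Y1 le_near.
  rewrite (offC f) (offE g) off_norm.
  have -> : g m2 + (g m1 - g m2) * (1 - zE) + (g m2 + (g m1 - g m2) * zE) =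
            g m1 + g m2 by ring.
  by rewrite leNgt lt_near.
- apply: not_loewner2_spec; rewrite (offC f) (offE g) off_norm.
  by move: lt_loewner; rewrite mul1r.
- rewrite /chao2 /mlog !mfun_spec //; apply: not_loewner2_spec.
  rewrite (offC (fun t => ln (f t))) (offE (fun t => ln (g t))) off_norm.
  by move: lt_chao; rewrite mul1r.
Unshelve. all: by end_near.
Qed.
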